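(* Let $n\ge 0$ be an integer and define $E:\Delta_n\to\mathbb{R}$ by $$E(x_0,\dots,x_n)=\sum_{k=0}^n\ \sum_{j=0}^\infty \frac{\{2^j x_k\}}{2^j}.$$ Then $E$ is an approximately convex function which vanishes on the vertices of $\Delta_n$ and has the following properties: (1) if $h:\Delta_n\to\mathbb{R}$ is an approximately convex function which is bounded or Borel measurable, and $h$ takes non-positive values on the vertices of $\Delta_n$, then $h(x)\le E(x)$ for all $x\in\Delta_n$; (2) $E$ achieves its maximum, and its maximum value is $\kappa(n)$; (3) $E$ is lower semi-continuous. Moreover, property (1) characterizes $E$ uniquely: $E$ is the only bounded approximately convex function on $\Delta_n$ which vanishes on the vertices and has property (1).
   Context: $\Delta_n=\{(\alpha_0,\dots,\alpha_n)\in\mathbb{R}^{n+1}:\alpha_k\ge 0,\ \sum_{k=0}^n\alpha_k=1\}$ is the standard simplex, whose vertices are the standard basis vectors $e_0,\dots,e_n$. $\{t\}=t-[t]$ is the fractional part of $t$, with $[\,\cdot\,]$ the greatest integer function. A function $h:C\to\mathbb{R}$ on a convex set $C$ is approximately convex if $h\bigl(\frac{a+b}{2}\bigr)\le\frac{h(a)+h(b)}{2}+1$ for all $a,b\in C$. The numbers $\kappa(n)$ are defined by $\kappa(0)=0$ and $\kappa(n)=[\log_2 n]+1+n/2^{[\log_2 n]}$ for $n\ge1$. *)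

(* Defs.v *)
From mathcomp Require Import all_boot all_order all_algebra.
From mathcomp Require Import all_classical all_reals all_analysis.

Set Implicit Arguments.
Unset Strict Implicit.
Unset Printing Implicit Defensive.

Import Order.TTheory GRing.Theory Num.Theory.
Import numFieldNormedType.Exports.

Local Open Scope classical_set_scope.
Local Open Scope ring_scope.

(* Functions on the simplex are rendered as total functions on the row vectors;
   every notion below only looks at their values on the simplex. *)
Definition simplex (R : realType) (n : nat) : set 'rV[R]_n.+1 :=
  [set x | (forall k, 0 <= x ord0 k) /\ \sum_k x ord0 k = 1].

Definition vertex (R : realType) (n : nat) (k : 'I_n.+1) : 'rV[R]_n.+1 :=
  delta_mx ord0 k.

Definition frac (R : realType) (t : R) : R := t - (Num.floor t)%:~R.

(* For a convex set C. *)
Definition approx_convex (R : realType) (V : lmodType R) (C : set V)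
    (h : V -> R) : Prop :=
  forall a b, C a -> C b -> h (2^-1 *: (a + b)) <= (h a + h b) / 2 + 1.

(* The domain carries the sigma-algebra generated by the open sets.  The simplex
   is closed, so this is measurability for its own Borel sigma-algebra. *)
Definition borel_measurable_on (R : realType) (n : nat) (D : set 'rV[R]_n.+1)
    (h : 'rV[R]_n.+1 -> R) : Prop :=
  measurable_fun (D : set (g_sigma_algebraType (@open 'rV[R]_n.+1)))
    (h : g_sigma_algebraType (@open 'rV[R]_n.+1) -> measurableTypeR R).

(* The j-th term lies in [0, 2^-j), so the limit of partial sums exists. *)
Definition Efun (R : realType) (n : nat) (x : 'rV[R]_n.+1) : R :=
  \sum_(k < n.+1)
    limn (series (fun j : nat => frac (2 ^+ j * x ord0 k) / 2 ^+ j)).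

Definition kappa (R : realType) (n : nat) : R :=
  if n == 0%N then 0 else
  let m : int := Num.floor (ln (n%:R : R) / ln 2) in
  m%:~R + 1 + n%:R / 2 ^ m.

Definition dominates_approx_convex (R : realType) (n : nat)
    (F : 'rV[R]_n.+1 -> R) : Prop :=
  forall h : 'rV[R]_n.+1 -> R,
    approx_convex (@simplex R n) h ->
    [bounded h x | x in @simplex R n] \/
      borel_measurable_on (@simplex R n) h ->
    (forall k, h (vertex R k) <= 0) ->
    forall x, simplex x -> h x <= F x.

(* Main.v *)
Require Import Defs.
From mathcomp Require Import all_boot all_order all_algebra.
From mathcomp Require Import all_classical all_reals all_analysis.
From mathcomp Require Import measurable_realfun.
From mathcomp Require Import ring lra zify.

Import Order.TTheory GRing.Theory Num.Theory.
Import numFieldNormedType.Exports.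
(* Restores frac as the fractional part: the fields of fractions use the same
   name. *)
Import Defs.

Local Open Scope classical_set_scope.
Local Open Scope ring_scope.

(** Write [s(t)] for the series [sum_j {2^j t} / 2^j], so that
    [E(x) = sum_k s(x_k)].  Everything rests on the self-similarity
    [s(t) = {t} + s(2t)/2] ([saw_rec]), together with [0 <= s <= 2].  A quantity
    that is bounded above and at most half of itself at another point is
    nonpositive ([halving_le0]); combined with [saw_rec], this turns properties
    of the fractional part into properties of [s].

    Approximate convexity.  [s] is subadditive since the fractional part is, so
    that [s((a+b)/2) <= (a+b)/2 + (s(a)+s(b))/2] for [a, b >= 0]; the first
    terms add up to 1 over the coordinates of a point of the simplex.

    Domination.  The inequality above is an equality when adding [a] to [b] in
    binary produces no carry.  If [x] is not a vertex, [2x] has coordinate sum 2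
    and can be split without carries into two points [a, b] of the simplex, [a]
    having dyadic coordinates ([carry_free_split]); hence
    [E(x) = (E(a)+E(b))/2 + 1].  Induction on the denominator gives [h <= E] at
    dyadic points, whence [(h-E)(x) <= (h-E)(b)/2] in general, and [halving_le0]
    concludes as soon as [h] is bounded above ([bounded_above_le_Efun]).  A
    Borel function satisfies this too.  On a segment, a measure argument bounds
    [h] in the middle, doubling towards an end bounds it everywhere, and halving
    makes the bound explicit: the maximum at the ends plus 2
    ([midconvex01_le]).  The explicit bound no longer depends on the segment, so
    it propagates from each face to the next dimension
    ([measurable_bounded_above]).

    Maximum.  [sum_k {2^j x_k}] is at most [2^j], and, being an integer less
    than [n+1], at most [n]; summing [min(2^j, n)/2^j] gives [kappa(n)].  For
    equality, let [m] be the integer part of [log_2 n]: it is enough that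
    [x_k < 2^-m] and that [2^(m+1) x_k = - v_k] modulo 1, where the [v_k] are
    permuted by doubling modulo 1 and add up to 1 ([sum_saw_cyc]).

    Lower semicontinuity passes from the fractional part to [s] through
    [saw_rec], because the error committed on [s(2t)] is halved.  Uniqueness is
    formal: two functions as in the statement dominate each other. *)

Set Implicit Arguments.
Unset Strict Implicit.
Unset Printing Implicit Defensive.

(** * The series of the fractional parts of 2^j t *)

Section Saw.
Variable R : realType.

(** Following the points [t'] from a [t] with [f t > 0], the value of [f] would
    at least double at each step and eventually exceed [C]. *)
Lemma halving_le0 (T : Type) (P : T -> Prop) (f : T -> R) (C : R) :
  (forall t, P t -> f t <= C) ->
  (forall t, P t -> f t <= 0 \/ exists2 t', P t' & f t <= f t' / 2) ->
  forall t, P t -> f t <= 0.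
Proof.
move=> fC fhalf.
have fCm m : forall t, P t -> 0 < f t -> f t * 2 ^+ m <= C.
  elim: m => [t Pt _|m IH t Pt ft0]; first by rewrite expr0 mulr1 fC.
  have [ft_le0|[t' Pt' ftt']] := fhalf t Pt; first by move: ft0; lra.
  have ft'0 : 0 < f t' by lra.
  apply: le_trans (IH t' Pt' ft'0).
  by rewrite exprS mulrA ler_wpM2r ?exprn_ge0 //; lra.
move=> t Pt; rewrite leNgt; apply/negP => ft0.
have [m Cm] : exists m : nat, C / f t < m%:R.
  by exists (Num.truncn (C / f t)).+1; rewrite truncnS_gt.
have := fCm m t Pt ft0; apply/negP; rewrite -ltNge.
rewrite ltr_pdivrMr // in Cm; apply: lt_le_trans Cm _.
rewrite mulrC ler_wpM2l ?(ltW ft0) // -natrX ler_nat.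
exact/ltnW/ltn_expl.
Qed.

Lemma frac_ge0 (t : R) : 0 <= frac t.
Proof. by rewrite /frac subr_ge0 floor_le. Qed.

Lemma frac_lt1 (t : R) : frac t < 1.
Proof. by have := floorD1_gt t; rewrite intrD /frac; lra. Qed.

Lemma fracDz (t : R) (z : int) : frac (t + z%:~R) = frac t.
Proof.
by rewrite /frac floorDrz ?intr_int // intrKfloor intrD; ring.
Qed.

Lemma frac_id (t : R) : 0 <= t -> t < 1 -> frac t = t.
Proof.
by move=> t0 t1; rewrite /frac (@floor_def _ _ 0) ?subr0 // t0 add0r t1.
Qed.

Lemma frac_le (t : R) : 0 <= t -> frac t <= t.
Proof. by move=> t0; rewrite /frac gerBl ler0z floor_ge0. Qed.

(** Near a point whose floor is [z] the hypothesis still holds, so that [frac] is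
    bounded below by a continuous function that agrees with it at the point: it
    is lower semicontinuous. *)
Lemma frac_le_subz (t : R) (z : int) : t < z%:~R + 1 -> t - z%:~R <= frac t.
Proof.
move=> tz; rewrite /frac lerB // ler_int -ltzD1 floor_lt_int intrD //.
Qed.

Lemma frac_truncn (t : R) : 0 <= t -> frac t = t - (Num.truncn t)%:R.
Proof.
move=> t0; rewrite /frac truncn_floor t0 natr_absz ger0_norm //.
by rewrite floor_ge0.
Qed.

Lemma frac_subadd (a b : R) : frac (a + b) <= frac a + frac b.
Proof.
have -> : a + b = (frac a + frac b) + (Num.floor a + Num.floor b)%:~R.
  by rewrite /frac intrD; ring.
by rewrite fracDz frac_le // addr_ge0 // frac_ge0.
Qed.

Definition saw (t : R) : R :=
  limn (series (fun j : nat => frac (2 ^+ j * t) / 2 ^+ j)).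

Let u_ (t : R) : R^nat := fun j : nat => frac (2 ^+ j * t) / 2 ^+ j.

Let u_ge0 (t : R) j : 0 <= u_ t j.
Proof. by rewrite divr_ge0 ?frac_ge0 // exprn_ge0. Qed.

Let sum_u_le (t : R) m : series (u_ t) m <= 2.
Proof.
suff : series (u_ t) m <= 2 - 2 / 2 ^+ m.
  by move/le_trans; apply; rewrite gerBl divr_ge0 // exprn_ge0.
elim: m => [|m IH]; first by rewrite /series /= big_nil expr0; lra.
rewrite seriesSr; apply: le_trans (lerD IH (_ : _ <= (2 ^+ m)^-1)) _.
  by rewrite /u_ ler_piMl ?invr_ge0 ?exprn_ge0 // ltW // frac_lt1.
by rewrite exprS invfM mulrA divff // mul1r; lra.
Qed.

Let is_cvg_u (t : R) : cvgn (series (u_ t)).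
Proof.
apply: nondecreasing_is_cvgn.
  by apply/nondecreasing_seqP => m; rewrite seriesSr lerDl.
by exists 2 => _ [m _ <-].
Qed.

Lemma saw_ge0 (t : R) : 0 <= saw t.
Proof.
apply: limr_ge; first exact: is_cvg_u.
by near=> m; apply: sumr_ge0 => j _; exact: u_ge0.
Unshelve. all: by end_near. Qed.

Lemma saw_le2 (t : R) : saw t <= 2.
Proof.
by apply: limr_le; [exact: is_cvg_u|near=> m; exact: sum_u_le].
Unshelve. all: by end_near. Qed.

(** The self-similarity from which all properties of [saw] are derived. *)
Lemma saw_rec (t : R) : saw t = frac t + saw (2 * t) / 2.
Proof.
have shift m : series (u_ t) m.+1 = frac t + series (u_ (2 * t)) m / 2.
  rewrite /series /= big_nat_recl // /u_ expr0 mul1r invr1 mulr1 mulr_suml.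
  congr (_ + _); apply: eq_bigr => j _.
  by rewrite exprSr mulrA invfM; ring.
apply: cvg_lim => //; rewrite -cvg_shiftS.
under eq_fun do rewrite shift.
apply: cvgD; first exact: cvg_cst.
by apply: cvgMl; exact: is_cvg_u.
Qed.

Lemma sawDz (t : R) (z : int) : saw (t + z%:~R) = saw t.
Proof.
rewrite /saw; congr (limn (series _)); apply/funext => j.
by rewrite mulrDr -natrX -(intrM _ (_ ^ _)%N) fracDz.
Qed.

Lemma saw0 : saw 0 = 0.
Proof.
have := saw_rec 0; rewrite mulr0 frac_id //; lra.
Qed.

Lemma sawDn (t : R) (p : nat) : saw (t + p%:R) = saw t.
Proof. exact: (sawDz t p). Qed.

Lemma sawBn (t : R) (p : nat) : saw (t - p%:R) = saw t.
Proof. by rewrite -(sawDz t (- p%:Z)) intrN. Qed.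

Lemma saw_nat (p : nat) : saw p%:R = 0.
Proof. by rewrite -[p%:R]add0r sawDn saw0. Qed.

(** By [saw_rec] and [frac_subadd], the defect [saw (a + b) - saw a - saw b] is at
    most half of the defect at [(2a, 2b)]. *)
Lemma saw_subadd (a b : R) : saw (a + b) <= saw a + saw b.
Proof.
rewrite -subr_le0.
pose f (p : R * R) := saw (p.1 + p.2) - (saw p.1 + saw p.2).
apply: (@halving_le0 (R * R)%type (fun=> True) f 2 _ _ (a, b)) => //.
  move=> [p q] _; rewrite /f /=.
  by have := saw_le2 (p + q); have := saw_ge0 p; have := saw_ge0 q; lra.
move=> [p q] _; right; exists (2 * p, 2 * q) => //; rewrite /f /=.
rewrite (saw_rec (p + q)) (saw_rec p) (saw_rec q) mulrDr.
by have := frac_subadd p q; lra.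
Qed.

End Saw.

(** * Splitting a vector without binary carries *)

Section Split.
Variable R : realType.

Lemma subvector_of_sum d (m : 'I_d -> nat) s : (s <= \sum_k m k)%N ->
  exists2 a : 'I_d -> nat, (forall k, a k <= m k)%N & (\sum_k a k = s)%N.
Proof.
elim: s => [_|s IH sm]; first by exists (fun=> 0%N) => //; rewrite big1.
have [a am suma] := IH (ltnW sm).
have [j ajm] : exists j, (a j < m j)%N.
  apply/existsP; rewrite -[X in is_true X]negbK negb_exists.
  apply/negP => /forallP aj.
  move: sm; rewrite -suma ltnNge leq_sum // => j _.
  by rewrite leqNgt aj.
exists (fun k => a k + (k == j))%N => [k|].
  by case: eqP => [->|_]; rewrite ?addn1 ?addn0.
rewrite big_split /= suma (bigD1 j) //= eqxx big1 ?addn1 //.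
by move=> k /negbTE ->.
Qed.

(** The vector [a] takes binary digits of the [y k], in decreasing order of
    weight, until their sum is [s].  The partial sums are multiples of the
    current weight, as [s] is, so they cannot jump over [s]; the hypothesis says
    that the digits up to the place [N] suffice.  Each fractional digit of [y k]
    goes entirely to [a k] or to [y k - a k], so no carry occurs, and [saw]
    ignores the integral parts; this is why it is additive here.

    The induction on [N] takes all the integral parts when their sum is less
    than [s], and then doubles the fractional parts. *)
Lemma carry_free_split d N (y : 'I_d -> R) (s : nat) :
  (forall k, 0 <= y k) -> (s * 2 ^ N <= \sum_k Num.truncn (2 ^+ N * y k)%R)%N ->
  exists a : 'I_d -> R,
    [/\ forall k, 0 <= a k <= y k, \sum_k a k = s%:R,
        forall k, 2 ^+ N * a k \is a Num.int &
        forall k, saw (a k) + saw (y k - a k) = saw (y k)].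
Proof.
(* When the integral parts suffice, an integral [a] will do. *)
have base M z p : (forall k, 0 <= z k) -> (p <= \sum_k Num.truncn (z k))%N ->
    exists a : 'I_d -> R,
    [/\ forall k, 0 <= a k <= z k, \sum_k a k = p%:R,
        forall k, 2 ^+ M * a k \is a Num.int &
        forall k, saw (a k) + saw (z k - a k) = saw (z k)].
  move=> z0 /subvector_of_sum[a az suma]; exists (fun k => (a k)%:R); split.
  - by move=> k; rewrite ler0n /= -truncn_ge_nat.
  - by rewrite -natr_sum suma.
  - by move=> k; rewrite -natrX -natrM intr_nat.
  - by move=> k; rewrite sawBn saw_nat add0r.
elim: N y s => [|N IH] y s y0.
  by under eq_bigr do rewrite expr0 mul1r; rewrite muln1; exact: base.
have [sy _|ys sy] := leqP s (\sum_k Num.truncn (y k)); first exact: base.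
have truncE k : Num.truncn (2 ^+ N.+1 * y k) =
    (2 ^ N.+1 * Num.truncn (y k) + Num.truncn (2 ^+ N * (2 * frac (y k)))%R)%N.
  rewrite -[in RHS](@natrK R (2 ^ N.+1 * _)) -truncnD.
  - by congr Num.truncn; rewrite frac_truncn // natrM natrX exprSr; ring.
  - exact: natr_nat.
  - by rewrite nnegrE !mulr_ge0 ?exprn_ge0 ?frac_ge0.
have [||a [a_le suma inta sawa]] :=
    IH (fun k => 2 * frac (y k)) (2 * (s - \sum_k Num.truncn (y k)))%N.
- by move=> k; rewrite mulr_ge0 ?frac_ge0.
- move: sy; under eq_bigr do rewrite truncE.
  by rewrite big_split /= -big_distrr /= expnS; nia.
have fracy k : frac (y k) < 1 := frac_lt1 (y k).
exists (fun k => (Num.truncn (y k))%:R + a k / 2); split.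
- move=> k; have := a_le k; have := frac_truncn (y0 k).
  by have := ler0n R (Num.truncn (y k)); lra.
- rewrite big_split /= -mulr_suml suma -natr_sum natrM natrB ?(ltnW ys) //.
  by field.
- move=> k; rewrite mulrDr exprSr rpredD //.
    by rewrite rpredM ?rpredM ?rpredX ?intr_nat.
  by rewrite (_ : _ * _ = 2 ^+ N * a k) //; field.
- move=> k; set q := Num.truncn (y k).
  have /andP[a0 a1] := a_le k; have fy := frac_truncn (y0 k).
  rewrite addrC -[saw (y k)](sawBn _ q) -/q -fy.
  have -> : y k - (q%:R + a k / 2) = frac (y k) - a k / 2 by rewrite fy; ring.
  rewrite (addrC _ (a k / 2)) -[q%:R]/(q%:~R) sawDz.
  have f1 := fracy k; have := sawa k; have f0 := frac_ge0 (y k).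
  move: (frac (y k)) f0 f1 a1 {fy} => f f0 f1 a1 sawf.
  rewrite (saw_rec f) (saw_rec (a k / 2)) (saw_rec (f - _)) !frac_id; try lra.
  rewrite (_ : 2 * (a k / 2) = a k); last by field.
  by rewrite (_ : 2 * (f - a k / 2) = 2 * f - a k); [lra|field].
Qed.

End Split.

(** * Approximate convexity of E, and domination for functions bounded above *)

Section Dom.
Variables (R : realType) (n : nat).
Implicit Types x a b : 'rV[R]_n.+1.
Local Notation Delta := (@simplex R n).
Local Notation E := (@Efun R n).

Lemma EfunE x : E x = \sum_k saw (x ord0 k).
Proof. by []. Qed.

Lemma Efun_ge0 x : 0 <= E x.
Proof. by rewrite EfunE sumr_ge0 // => k _; exact: saw_ge0. Qed.

Lemma Efun_vertex k : E (vertex R k) = 0.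
Proof.
by rewrite EfunE big1 // => j _; rewrite mxE saw_nat.
Qed.

Lemma simplex_vertex (k : 'I_n.+1) : Delta (vertex R k).
Proof.
split=> [j|]; first by rewrite mxE ler0n.
rewrite (bigD1 k) //= mxE !eqxx big1 ?addr0 // => j /negbTE jk.
by rewrite mxE jk andbF.
Qed.

Lemma simplex_ge1_vertex x k : Delta x -> 1 <= x ord0 k -> x = vertex R k.
Proof.
move=> [x0 sumx] xk1; move: sumx; rewrite (bigD1 k) //= => sumx.
have rest0 : \sum_(j | j != k) x ord0 j = 0.
  by apply/eqP; rewrite eq_le sumr_ge0 // andbT; lra.
apply/rowP => j; rewrite mxE eqxx /=; case: eqVneq => [->|jk].
  by move: sumx; rewrite rest0 addr0.
move/eqP: rest0; rewrite psumr_eq0 // => /allP/(_ j).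
by rewrite mem_index_enum jk => /(_ isT)/eqP.
Qed.

Lemma simplex_vertex_or_lt1 x : Delta x ->
  (exists k, x = vertex R k) \/ (forall k, x ord0 k < 1).
Proof.
move=> Dx; have [/existsP[k xk]|] := boolP [exists k, 1 <= x ord0 k].
  by left; exists k; exact: simplex_ge1_vertex.
rewrite negb_exists => /forallP xlt; right => k.
by rewrite ltNge xlt.
Qed.

Lemma simplex_midpoint x a b : x = 2^-1 *: (a + b) ->
  forall k, x ord0 k = (a ord0 k + b ord0 k) / 2.
Proof. by move=> -> k; rewrite !mxE mulrC. Qed.

(** Splitting [2x], whose coordinate sum is 2, without carries gives two points
    of the simplex for which approximate convexity of [E] is an equality.  The
    extra 1 is [sum_k {x_k}], which equals [sum_k x_k] away from the
    vertices. *)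
Lemma simplex_split x N : Delta x -> (forall k, x ord0 k < 1) ->
  (2 ^ N <= \sum_k Num.truncn (2 ^+ N * (2 * x ord0 k))%R)%N ->
  exists a b, [/\ Delta a, Delta b, x = 2^-1 *: (a + b),
    forall k, 2 ^+ N * a ord0 k \is a Num.int & E x = (E a + E b) / 2 + 1].
Proof.
move=> [x0 sumx] x1 Nx.
have [||a [a_le suma inta sawa]] :=
    @carry_free_split R _ N (fun k => 2 * x ord0 k) 1.
- by move=> k; rewrite mulr_ge0.
- by rewrite mul1n.
exists (\row_k a k), (\row_k (2 * x ord0 k - a k)); split.
- split=> [k|]; first by rewrite mxE; case/andP: (a_le k).
  by rewrite -[RHS]suma; apply: eq_bigr => k _; rewrite mxE.
- split=> [k|]; first by rewrite mxE subr_ge0; case/andP: (a_le k).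
  under eq_bigr do rewrite mxE.
  by rewrite sumrB -mulr_sumr sumx suma; lra.
- by apply/rowP => k; rewrite !mxE; field.
- by move=> k; rewrite mxE.
- rewrite !EfunE -[X in X / 2]big_split /= -[X in _ = _ + X]sumx.
  rewrite mulr_suml -[RHS]big_split /=.
  apply: eq_bigr => k _; rewrite !mxE sawa saw_rec frac_id //.
  exact: addrC.
Qed.

(** The two points given by [simplex_split] have denominator [2^N] when [x] has
    denominator [2^(N+1)]. *)
Lemma dyadic_le_Efun (h : 'rV[R]_n.+1 -> R) :
  approx_convex Delta h -> (forall k, h (vertex R k) <= 0) ->
  forall N x, Delta x -> (forall k, 2 ^+ N * x ord0 k \is a Num.int) ->
  h x <= E x.
Proof.
move=> hconv hvert; elim=> [|N IH] x Dx intx.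
  have [[k ->]|x1] := simplex_vertex_or_lt1 Dx; first by rewrite Efun_vertex.
  have [x0 sumx] := Dx.
  have: \sum_k x ord0 k = 0.
    apply: big1 => k _; have := frac_id (x0 k) (x1 k); rewrite /frac.
    by have := intx k; rewrite expr0 mul1r => /floorK ->; rewrite subrr.
  by rewrite sumx => /eqP; rewrite oner_eq0.
have [[k ->]|x1] := simplex_vertex_or_lt1 Dx; first by rewrite Efun_vertex.
have [x0 sumx] := Dx.
have [|a [b [Da Db xab inta ->]]] := @simplex_split x N Dx x1.
  rewrite -(ler_nat R) sum_truncnK => [|k _].
    by rewrite -2!mulr_sumr sumx natrX ler_peMr ?exprn_ge0 //; lra.
  by rewrite natrEint mulrA -exprSr intx !mulr_ge0 ?exprn_ge0.
have intb k : 2 ^+ N * b ord0 k \is a Num.int.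
  have := intx k; rewrite exprSr (simplex_midpoint xab) => ib.
  rewrite (_ : _ * _ = 2 ^+ N * 2 * ((a ord0 k + b ord0 k) / 2)
    - 2 ^+ N * a ord0 k); last by field.
  by rewrite rpredB.
have := hconv _ _ Da Db; rewrite -xab.
by have := IH _ Da inta; have := IH _ Db intb; lra.
Qed.

(** In [simplex_split] the point [a] is dyadic, so [h - E] is nonpositive there
    and [(h - E)(x)] is at most half of [(h - E)(b)]. *)
Lemma bounded_above_le_Efun (h : 'rV[R]_n.+1 -> R) (C : R) :
  approx_convex Delta h -> (forall k, h (vertex R k) <= 0) ->
  (forall x, Delta x -> h x <= C) ->
  forall x, Delta x -> h x <= E x.
Proof.
move=> hconv hvert hC x Dx; rewrite -subr_le0.
apply: (@halving_le0 R _ Delta (fun x => h x - E x) C) Dx => {}x Dx.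
  by have := hC x Dx; have := Efun_ge0 x; lra.
have [[k ->]|x1] := simplex_vertex_or_lt1 Dx.
  by left; rewrite Efun_vertex subr0.
right; have [x0 sumx] := Dx.
(* Truncation loses less than 1 on each of the [n.+1] coordinates, out of a total
   of [2 ^ n.+2]; at least [2 ^ n.+1] remains because [n.+1 <= 2 ^ n.+1]. *)
have [|a [b [Da Db xab inta ->]]] := @simplex_split x n.+1 Dx x1.
  have : \sum_k 2 ^+ n.+1 * (2 * x ord0 k) <=
      \sum_k (Num.truncn (2 ^+ n.+1 * (2 * x ord0 k))).+1%:R.
    by apply: ler_sum => k _; exact/ltW/truncnS_gt.
  rewrite -2!mulr_sumr sumx mulr1 -natr_sum -natrX -natrM ler_nat.
  under eq_bigr do rewrite -addn1.
  rewrite big_split /= sum1_card card_ord.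
  by have := ltn_expl n.+1 (ltnSn 1); lia.
exists b => //; have := hconv _ _ Da Db; rewrite -xab.
by have := dyadic_le_Efun hconv hvert Da inta; lra.
Qed.

Lemma Efun_approx_convex : approx_convex Delta E.
Proof.
move=> a b [a0 suma] [b0 sumb].
set x := 2^-1 *: (a + b); have xE := simplex_midpoint (erefl x).
have sumx : \sum_k x ord0 k = 1.
  under eq_bigr do rewrite xE.
  by rewrite -mulr_suml big_split /= suma sumb; field.
rewrite -[X in _ <= _ + X]sumx !EfunE -[X in X / 2]big_split /= mulr_suml.
rewrite -[leRHS]big_split /=.
apply: ler_sum => k _; rewrite [leLHS]saw_rec [leLHS]addrC; apply: lerD.
  rewrite ler_wpM2r // xE (_ : 2 * _ = a ord0 k + b ord0 k); last by field.
  exact: saw_subadd.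
by rewrite frac_le // xE divr_ge0 // addr_ge0.
Qed.

End Dom.

(** * Measurable approximately convex functions on a segment *)

Section Segment.
Variable R : realType.
Local Notation mu := (@lebesgue_measure R).
Local Notation mR := (measurableTypeR R).

Lemma measurable_subr (c : R) : measurable_fun [set: mR] (fun s : mR => c - s : mR).
Proof.
apply: continuous_measurable_fun => s; apply: cvgB; first exact: cvg_cst.
exact: cvg_id.
Qed.

Lemma preimage_subr_itv (c a b : R) (ba bb : bool) :
  (fun s => c - s) @^-1` [set` Interval (BSide ba a) (BSide bb b)] =
  [set` Interval (BSide (~~ bb) (c - b)) (BSide (~~ ba) (c - a))].
Proof.
by apply/seteqP; split=> s; rewrite /= !itv_boundlr;
  case: ba; case: bb; rewrite /= ?bnd_simp => /andP[? ?]; apply/andP; split; lra.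
Qed.

Lemma lebesgue_measure_reflect (c : R) (A : set mR) : measurable A ->
  mu ((fun s => c - s) @^-1` A) = mu A.
Proof.
move=> mA; rewrite -[LHS]/(pushforward mu (fun s : mR => c - s : mR) A).
apply/esym/lebesgue_measure_unique => //=; first exact: measurable_subr.
move=> _ _ [[a b]] _ <-.
rewrite /pushforward preimage_subr_itv /= !lebesgue_measure_itv /= !lte_fin.
rewrite ltrD2l ltrN2; case: ifP => // _; rewrite -!EFinD; congr EFin; ring.
Qed.

Definition midconvex01 (g : R -> R) := forall s t : R,
  0 <= s <= 1 -> 0 <= t <= 1 -> g ((s + t) / 2) <= (g s + g t) / 2 + 1.

(** The sets [{g > M}] decrease to the empty set, so one of them has measure less
    than 1/4.  For [t] in the middle half, that set and its reflection about [t]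
    do not cover the interval of length 1/2 centred at [t], and a point outside
    both exhibits [t] as the midpoint of two points where [g <= M]. *)
Lemma midconvex01_bounded_middle (g : R -> R) :
  measurable_fun (`[0, 1]%classic : set mR) (g : mR -> mR) -> midconvex01 g ->
  exists C, forall t, 4^-1 <= t <= 3 / 4 -> g t <= C.
Proof.
move=> mg gconv.
pose F (M : nat) : set mR := `[0, 1]%classic `&` g @^-1` `]M%:R, +oo[%classic.
have mF M : measurable (F M) by apply: mg => //; exact: measurable_itv.
have F01 M : (mu (F M) <= 1)%E.
  apply: (@le_trans _ _ (mu `[0, 1]%classic)).
    by apply: le_measure; rewrite ?inE // => ? [].
  by rewrite lebesgue_measure_itv /= lte_fin ltr01 oppr0 adde0.
have F_cvg : mu \o F @ \oo --> mu (\bigcap_M F M).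
  apply: nonincreasing_cvg_mu => //.
  - by apply: le_lt_trans (F01 _) _; rewrite ltry.
  - by apply: bigcapT_measurable.
  - move=> p q pq; apply/subsetPset => t [t01]; rewrite /= !in_itv /= !andbT => qt.
    by split => //=; rewrite in_itv /= andbT (le_lt_trans _ qt) // ler_nat.
have F0 : \bigcap_M F M = set0.
  apply/seteqP; split=> // t /(_ (Num.truncn (g t)).+1 I) [_].
  rewrite /= in_itv /= andbT => gt; have := truncnS_gt (g t).
  by rewrite ltNge (ltW gt).
rewrite F0 measure0 in F_cvg.
have [M FM] : exists M, (mu (F M) < 4^-1%:E)%E.
  have : nbhs (0%E : \bar R) [set x | (x < 4^-1%:E)%E].
    by apply: open_ereal_lt'; rewrite lte_fin.
  by move=> /F_cvg[M _ /(_ M (leqnn M)) FM]; exists M.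
exists (M%:R + 1) => t /andP[t1 t2]; rewrite leNgt; apply/negP => gt.
pose refl := (fun s => 2 * t - s) : mR -> mR.
have mrefl : measurable (refl @^-1` F M).
  by rewrite -[X in measurable X]setTI; exact: measurable_subr.
have reflE : mu (refl @^-1` F M) = mu (F M).
  exact: lebesgue_measure_reflect.
have cover : `[(t - 4^-1)%R, (t + 4^-1)%R]%classic `<=` F M `|` refl @^-1` F M.
  move=> s /=; rewrite in_itv /= => /andP[s1 s2].
  have s01 : 0 <= s <= 1 by lra.
  have r01 : 0 <= 2 * t - s <= 1 by lra.
  have := gconv _ _ s01 r01; rewrite (_ : (s + _) / 2 = t); last by field.
  move=> gle; have [sM|sM] := ltP M%:R (g s).
    by left; split; rewrite /= in_itv /= ?andbT.
  by right; split; rewrite /refl /= in_itv /= ?andbT //; lra.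
have : (mu `[(t - 4^-1)%R, (t + 4^-1)%R]%classic <= mu (F M) + mu (F M))%E.
  rewrite -{2}reflE; apply: le_trans (measureU2 mu (mF M) mrefl).
  by apply: le_measure; rewrite ?inE //; exact: measurableU.
apply/negP; rewrite -ltNge lebesgue_measure_itv /= lte_fin ifT; last by lra.
have -> : ((t + 4^-1)%:E - (t - 4^-1)%:E)%E = (4^-1%:E + 4^-1%:E)%E :> \bar R.
  by rewrite -!EFinD; congr EFin; lra.
by apply: lteD.
Qed.

(** Since [t] is the midpoint of 0 and [2t], a bound [C >= g 0 + 2] passes from
    [2t] to [t]: [(g 0 + C) / 2 + 1 <= C]. *)
Lemma midconvex01_bounded_near0 (g : R -> R) (C : R) : midconvex01 g ->
  g 0 + 2 <= C -> (forall t, 4^-1 <= t <= 2^-1 -> g t <= C) ->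
  forall t, 0 <= t <= 2^-1 -> g t <= C.
Proof.
move=> gconv g0 gmid t; have [->|t_neq0] := eqVneq t 0; first by move=> _; lra.
move=> /andP[t0 t12]; have {}t0 : 0 < t by rewrite lt_neqAle eq_sym t_neq0.
have [m tm] : exists m, 4^-1 <= 2 ^+ m * t.
  exists (Num.truncn t^-1).+1; rewrite -ler_pdivrMr //.
  have := truncnS_gt t^-1; set p := _.+1 => tp.
  have : (p%:R : R) <= 2 ^+ p by rewrite -natrX ler_nat ltnW // ltn_expl.
  have : 0 < t^-1 by rewrite invr_gt0.
  by lra.
elim: m t {t_neq0} t0 t12 tm => [|m IH] t t0 t12.
  by rewrite expr0 mul1r => tm; apply: gmid; rewrite tm.
rewrite exprSr -mulrA => tm; have [t4|t4] := leP 4^-1 t.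
  by apply: gmid; rewrite t4.
have := IH (2 * t); have := gconv 0 (2 * t).
rewrite (_ : (0 + 2 * t) / 2 = t); last by field.
move=> h1 h2; have : g (2 * t) <= C by apply: h2; lra.
have : g t <= (g 0 + g (2 * t)) / 2 + 1 by apply: h1; lra.
by lra.
Qed.

Lemma midconvex01_bounded (g : R -> R) :
  measurable_fun (`[0, 1]%classic : set mR) (g : mR -> mR) -> midconvex01 g ->
  exists C, forall t, 0 <= t <= 1 -> g t <= C.
Proof.
move=> mg gconv; have [M gM] := midconvex01_bounded_middle mg gconv.
pose C := Num.max M (Num.max (g 0 + 2) (g 1 + 2)).
have CM : M <= C by rewrite le_max lexx.
have C0 : g 0 + 2 <= C by rewrite !le_max lexx orbT.
have C1 : g 1 + 2 <= C by rewrite !le_max lexx !orbT.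
exists C => t t01; have [t12|t12] := leP t 2^-1.
  have gmid s : 4^-1 <= s <= 2^-1 -> g s <= C.
    by move=> s01; apply: le_trans CM; apply: gM; lra.
  have t012 : 0 <= t <= 2^-1 by lra.
  exact: midconvex01_bounded_near0 gconv C0 gmid t t012.
rewrite -[t](subKr 1).
apply: (@midconvex01_bounded_near0 (fun s => g (1 - s))); last by lra.
- move=> s r s01 r01; rewrite (_ : 1 - _ = ((1 - s) + (1 - r)) / 2); last by field.
  by apply: gconv; lra.
- by rewrite subr0.
- by move=> s s01; apply: le_trans CM; apply: gM; lra.
Qed.

(** Once [g] is known to be bounded, halving towards the nearer end replaces the
    bound by one that depends only on the values at the ends. *)
Lemma midconvex01_le (g : R -> R) (G : R) :
  measurable_fun (`[0, 1]%classic : set mR) (g : mR -> mR) -> midconvex01 g ->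
  g 0 <= G -> g 1 <= G -> forall t, 0 <= t <= 1 -> g t <= G + 2.
Proof.
move=> mg gconv g0 g1 t t01; rewrite -subr_le0.
have [C gC] := midconvex01_bounded mg gconv.
apply: (@halving_le0 R _ (fun t => 0 <= t <= 1) (fun t => g t - (G + 2))
  (C - (G + 2))) t01 => {}t t01; first by rewrite lerB // gC.
right; have [t12|t12] := leP t 2^-1.
- exists (2 * t); first by lra.
  have := gconv 0 (2 * t); rewrite (_ : (0 + 2 * t) / 2 = t); last by field.
  by move=> gt; have : g t <= (g 0 + g (2 * t)) / 2 + 1 by [apply: gt; lra]; lra.
- exists (2 * t - 1); first by lra.
  have := gconv 1 (2 * t - 1); rewrite (_ : (1 + (2 * t - 1)) / 2 = t); last by field.
  move=> gt; have : g t <= (g 1 + g (2 * t - 1)) / 2 + 1 by apply: gt; lra.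
  by lra.
Qed.

End Segment.

(** * Borel approximately convex functions on the simplex are bounded above *)

Section Borel.
Variables (R : realType) (n : nat).
Implicit Types x p q : 'rV[R]_n.+1.
Local Notation Delta := (@simplex R n).
Local Notation mR := (measurableTypeR R).
Local Notation borelV := (g_sigma_algebraType (@open 'rV[R]_n.+1)).

Lemma closed_simplex : closed Delta.
Proof.
have -> : Delta = (\bigcap_k [set x : 'rV[R]_n.+1 | 0 <= x ord0 k]) `&`
    [set x : 'rV[R]_n.+1 | \sum_k x ord0 k = 1].
  apply/seteqP; split=> x [x0 sumx]; split=> // k; [by move=> _; exact: x0|].
  exact: x0.
apply: closedI.
  apply: closed_bigI => k _.
  have /continuous_closedP cont : continuous (fun x : 'rV[R]_n.+1 => x ord0 k).
    exact: coord_continuous.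
  exact: cont [set y | 0 <= y] (@closed_ge R 0).
have /continuous_closedP cont : continuous (fun x : 'rV[R]_n.+1 => \sum_k x ord0 k).
  by apply: continuous_big => [|k _]; [exact: add_continuous|exact: coord_continuous].
exact: cont [set 1] (@closed_eq R 1).
Qed.

Lemma measurable_simplex : measurable (Delta : set borelV).
Proof.
rewrite -[X in measurable X]setCK; apply: measurableC.
by apply: sub_sigma_algebra; apply: closed_openC; exact: closed_simplex.
Qed.

Definition segment p q (t : R) : 'rV[R]_n.+1 := (1 - t) *: p + t *: q.

Lemma continuous_segment p q : continuous (segment p q).
Proof.
move=> t; apply: cvgD; apply: cvgZl.
  by apply: cvgB; [exact: cvg_cst|exact: cvg_id].
exact: cvg_id.
Qed.

Lemma measurable_segment p q :
  measurable_fun (`[0, 1]%classic : set mR) (segment p q : mR -> borelV).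
Proof.
apply: (@measurable_funS _ _ _ _ setT) => //.
apply: (@measurability _ _ mR borelV setT (segment p q) (@open 'rV[R]_n.+1)) => //.
move=> _ [U oU <-]; apply: measurableI => //; apply: open_measurable.
by apply: open_comp => // t _; exact: continuous_segment.
Qed.

Lemma segment_simplex p q t : Delta p -> Delta q -> 0 <= t <= 1 ->
  Delta (segment p q t).
Proof.
move=> [p0 sump] [q0 sumq] /andP[t0 t1]; split=> [k|].
  by rewrite !mxE addr_ge0 // mulr_ge0 // subr_ge0.
under eq_bigr do rewrite !mxE.
by rewrite big_split /= -!mulr_sumr sump sumq !mulr1 subrK.
Qed.

Lemma segment_le (h : 'rV[R]_n.+1 -> R) (G : R) p q :
  approx_convex Delta h -> borel_measurable_on Delta h ->
  Delta p -> Delta q -> h p <= G -> h q <= G ->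
  forall t, 0 <= t <= 1 -> h (segment p q t) <= G + 2.
Proof.
move=> hconv hmeas Dp Dq hp hq.
apply: (@midconvex01_le R (h \o segment p q)) => /=.
- apply: (@measurable_comp _ _ _ _ _ _ (Delta : set borelV)) => //.
  + exact: measurable_simplex.
  + move=> _ [t t01 <-]; exact: segment_simplex.
  + exact: measurable_segment.
- move=> s t s01 t01 /=.
  have <- : 2^-1 *: (segment p q s + segment p q t) = segment p q ((s + t) / 2).
    by apply/rowP => k; rewrite !mxE; field.
  by apply: hconv; exact: segment_simplex.
- by rewrite /segment subr0 scale1r scale0r addr0.
- by rewrite /segment subrr scale1r scale0r add0r.
Qed.

(** Induction on the number of nonzero coordinates: a point that is not a vertex
    lies on a segment from a vertex to a point [q] with one coordinate fewer,
    and [segment_le] adds 2 to the bound. *)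
Lemma measurable_bounded_above (h : 'rV[R]_n.+1 -> R) :
  approx_convex Delta h -> borel_measurable_on Delta h ->
  (forall k, h (vertex R k) <= 0) ->
  forall d x, Delta x -> (#|[set k | x ord0 k != 0%R]%SET| <= d)%N ->
  h x <= 2 * d%:R.
Proof.
move=> hconv hmeas hvert; elim=> [|d IH] x Dx suppx.
  move: suppx; rewrite leqn0 cards_eq0 => /eqP supp0.
  have [_] := Dx; rewrite big1 => [/eqP|k _]; first by rewrite eq_sym oner_eq0.
  by have := finset.in_set0 k; rewrite -supp0 finset.in_set => /negbFE/eqP.
have [[k ->]|x1] := simplex_vertex_or_lt1 Dx.
  by apply: le_trans (hvert k) _; rewrite mulr_ge0.
have [x0 sumx] := Dx.
have [k xk0] : exists k, x ord0 k != 0.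
  apply/existsP; apply: contraT; rewrite negb_exists => /forallP x_eq0.
  move: sumx; rewrite big1 => [/eqP|k _]; first by rewrite eq_sym oner_eq0.
  by apply/eqP; rewrite -[_ == _]negbK x_eq0.
have xk1 : 0 < 1 - x ord0 k by rewrite subr_gt0.
pose q := (1 - x ord0 k)^-1 *: (x - x ord0 k *: vertex R k).
have qk : q ord0 k = 0 by rewrite !mxE !eqxx mulr1 subrr mulr0.
have qj j : j != k -> q ord0 j = x ord0 j / (1 - x ord0 k).
  by move=> /negbTE jk; rewrite !mxE jk andbF mulr0 subr0 mulrC.
have Dq : Delta q.
  split=> [j|].
    have [->|jk] := eqVneq j k; first by rewrite qk.
    by rewrite qj // divr_ge0 // ltW.
  rewrite (bigD1 k) //= qk add0r (eq_bigr _ (fun j jk => qj j jk)) -mulr_suml.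
  move: sumx; rewrite (bigD1 k) //= => sumx.
  rewrite (_ : \sum_(i < n.+1 | i != k) _ = 1 - x ord0 k); last by rewrite -sumx; ring.
  by rewrite divff // gt_eqF.
have xE : x = segment q (vertex R k) (x ord0 k).
  rewrite /segment /q scalerA divff ?gt_eqF // scale1r subrK //.
have -> : 2 * d.+1%:R = 2 * d%:R + 2 :> R by rewrite -(addn1 d) natrD; ring.
rewrite xE; apply: segment_le => //.
- exact: simplex_vertex.
- apply: IH => //; rewrite -ltnS; apply: leq_trans suppx.
  apply: proper_card; apply/properP; split.
    apply/fintype.subsetP => j; rewrite !finset.in_set.
    have [->|jk] := eqVneq j k; first by rewrite qk eqxx.
    by rewrite qj // mulf_eq0 negb_or => /andP[].
  by exists k; rewrite !finset.in_set // qk eqxx.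
- by apply: le_trans (hvert k) _; rewrite mulr_ge0.
- by rewrite x0 /= ltW.
Qed.

End Borel.

(** * The maximum of E *)

Section Max.
Variables (R : realType) (n : nat).
Implicit Types x : 'rV[R]_n.+1.
Local Notation Delta := (@simplex R n).
Local Notation E := (@Efun R n).

(** The left-hand side is an integer less than [n + 1]. *)
Lemma sum_frac_le (y : 'I_n.+1 -> R) : \sum_k y k \is a Num.int ->
  \sum_k frac (y k) <= n%:R.
Proof.
move=> inty; have intfrac : \sum_k frac (y k) \is a Num.int.
  by rewrite sumrB rpredB // rpred_sum // => k _; exact: intr_int.
have lt_n1 : \sum_k frac (y k) < n.+1%:R.
  have -> : n.+1%:R = \sum_(k < n.+1) 1 :> R.
    by rewrite big_const_ord iter_addr_0.
  rewrite ltr_sum //; first by apply/hasP; exists ord0; rewrite ?mem_index_enum.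
  by move=> k _; exact: frac_lt1.
move: lt_n1; rewrite -(floorK intfrac) -[n.+1%:R]/(n.+1%:~R) -[n%:R]/(n%:~R).
by rewrite ltr_int ler_int; lia.
Qed.

Lemma sum_saw_le (y : 'I_n.+1 -> R) : \sum_k y k \is a Num.int ->
  \sum_k saw (y k) <= 2 * n%:R.
Proof.
move=> inty; rewrite -subr_le0.
apply: (@halving_le0 R _ (fun y => \sum_k y k \is a Num.int)
  (fun y : 'I_n.+1 -> R => \sum_k saw (y k) - 2 * n%:R)
  (\sum_(k < n.+1) 2)) inty => {}y inty.
  have : \sum_k saw (y k) <= \sum_(k < n.+1) 2.
    by apply: ler_sum => k _; exact: saw_le2.
  by have := ler0n R n; lra.
right; exists (fun k => 2 * y k).
  by rewrite -mulr_sumr; apply: rpredM => //; exact: (natr_int _ 2).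
under eq_bigr do rewrite saw_rec.
rewrite big_split /= -mulr_suml.
by have := sum_frac_le inty; lra.
Qed.

Lemma Efun_unfold x (m : nat) :
  E x = \sum_(j < m) (\sum_k frac (2 ^+ j * x ord0 k)) / 2 ^+ j +
        (\sum_k saw (2 ^+ m * x ord0 k)) / 2 ^+ m.
Proof.
elim: m => [|m IH].
  by rewrite big_ord0 add0r expr0 divr1; under [RHS]eq_bigr do rewrite mul1r.
rewrite IH [X in _ = X + _]big_ord_recr /= -addrA; congr (_ + _).
under eq_bigr do rewrite saw_rec mulrA -exprS.
by rewrite big_split /= mulrDl -mulr_suml -mulrA -invfM -exprS.
Qed.

Lemma sum_scaled_simplex x (j : nat) : Delta x ->
  \sum_k 2 ^+ j * x ord0 k = 2 ^+ j.
Proof. by move=> [_ sumx]; rewrite -mulr_sumr sumx mulr1. Qed.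

Lemma kappaE (m : nat) : (2 ^ m <= n < 2 ^ m.+1)%N ->
  kappa R n = m%:R + 1 + n%:R / 2 ^+ m.
Proof.
move=> /andP[mn nm]; have n0 : (0 < n)%N by apply: leq_trans mn; rewrite expn_gt0.
rewrite /kappa gtn_eqF //.
rewrite (_ : Num.floor _ = m%:Z) //; apply: floor_def.
have ln2 : 0 < ln 2 :> R by rewrite ln_gt0 // ltr1n.
have ln2X p : ln (2 ^+ p) = p%:R * ln 2 :> R by rewrite lnXn // mulr_natl.
rewrite ler_pdivlMr // ltr_pdivrMr //.
rewrite -[m%:~R]/(m%:R : R) -[(m%:Z + 1)%:~R]/((m + 1)%N%:R : R) addn1.
rewrite -!ln2X ler_ln ?ltr_ln ?posrE ?exprn_gt0 ?ltr0n //.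
by rewrite -!natrX ler_nat ltr_nat mn nm.
Qed.

Lemma trunc_log_bounds : (0 < n)%N ->
  (2 ^ trunc_log 2 n <= n < 2 ^ (trunc_log 2 n).+1)%N.
Proof. by move=> n0; rewrite trunc_logP // trunc_log_ltn. Qed.

Lemma Efun_le_kappa x : Delta x -> E x <= kappa R n.
Proof.
move=> Dx; have [x0 sumx] := Dx.
have [n0|n0] := posnP n.
  have := @sum_saw_le (fun k => x ord0 k); rewrite sumx => /(_ (rpred1 _)).
  have -> : kappa R n = 0 by rewrite /kappa n0 eqxx.
  by have -> : n%:R = 0 :> R; [rewrite n0|rewrite mulr0].
rewrite (kappaE (trunc_log_bounds n0)); set m := trunc_log 2 n.
rewrite (Efun_unfold x m.+1) -[m%:R + 1]/(m%:R + 1%:R) -natrD addn1; apply: lerD.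
  have -> : m.+1%:R = \sum_(j < m.+1) 1 :> R by rewrite big_const_ord iter_addr_0.
  apply: ler_sum => j _; rewrite ler_pdivrMr ?exprn_gt0 // mul1r.
  rewrite -[leRHS](sum_scaled_simplex j Dx); apply: ler_sum => k _.
  by rewrite frac_le // mulr_ge0 ?exprn_ge0.
rewrite exprS invfM mulrA ler_pM2r ?invr_gt0 ?exprn_gt0 //.
rewrite ler_pdivrMr // [leRHS]mulrC sum_saw_le // -exprS sum_scaled_simplex //.
by apply: rpredX; exact: (natr_int _ 2).
Qed.

(** The binary expansion of [cyc k] is periodic of period [n+1], with one digit 1
    per period, whose place depends on [k]: doubling modulo 1 maps [cyc k] to
    [cyc k.+1] and [cyc n] to [cyc 0]. *)
Definition cyc (k : nat) : R := 2 ^+ k / (2 ^+ n.+1 - 1).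

Lemma cyc_den_gt0 : 0 < 2 ^+ n.+1 - 1 :> R.
Proof. by rewrite subr_gt0 exprn_egt1 // ltr1n. Qed.

Lemma cyc_gt0 k : 0 < cyc k.
Proof. by rewrite divr_gt0 ?exprn_gt0 ?cyc_den_gt0. Qed.

Lemma sum_cyc : \sum_(k < n.+1) cyc k = 1.
Proof.
rewrite -mulr_suml; have -> : \sum_(k < n.+1) 2 ^+ k = 2 ^+ n.+1 - 1 :> R.
  elim: (n.+1) => [|p IH]; first by rewrite big_ord0 expr0 subrr.
  by rewrite big_ord_recr /= IH exprS; ring.
by rewrite divff // gt_eqF // cyc_den_gt0.
Qed.

Lemma cyc_le1 (k : 'I_n.+1) : cyc k <= 1.
Proof.
rewrite -sum_cyc (bigD1 k) //= lerDl sumr_ge0 // => j _.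
by rewrite ltW // cyc_gt0.
Qed.

(** Doubling permutes the numbers [- cyc k] modulo 1, so by [saw_rec] the sum [S]
    satisfies [S = n + S / 2]. *)
Lemma sum_saw_cyc : \sum_(k < n.+1) saw (- cyc k) = 2 * n%:R.
Proof.
have fracE (k : 'I_n.+1) : frac (- cyc k) = 1 - cyc k.
  rewrite -(fracDz _ 1) addrC frac_id //; have := cyc_gt0 k; have := cyc_le1 k; lra.
have : \sum_(k < n.+1) saw (- cyc k) =
    n%:R + (\sum_(k < n.+1) saw (- cyc k)) / 2.
  under [LHS]eq_bigr do rewrite saw_rec fracE.
  rewrite big_split /= sumrB sum_cyc big_const_ord iter_addr_0 -[n.+1%:R]natr1 addrK.
  rewrite -mulr_suml; congr (_ + _ / 2).
  rewrite big_ord_recr [RHS]big_ord_recl /= addrC; congr (_ + _).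
    have -> : 2 * - cyc n = - cyc 0 + (-1)%:~R.
      rewrite /cyc expr0 exprS; have := cyc_den_gt0; rewrite exprS => den.
      by field; rewrite gt_eqF.
    exact: sawDz.
  apply: eq_bigr => k _; congr saw.
  by rewrite /cyc /bump leq0n add1n (exprS _ k); ring.
lra.
Qed.

(** The bounds used in [Efun_le_kappa] are all equalities when [x_k < 2^-m] and
    [2^(m+1) x_k] is congruent to [- cyc k] modulo 1.  The integers [1 + d k]
    that are added to [- cyc k] are 1 or 2, so that [0 <= 2^(m+1) x_k < 2]; the
    number of 2's is imposed by the sum of the coordinates. *)
Lemma Efun_max_attained : exists2 x, Delta x & E x = kappa R n.
Proof.
have [n0|n0] := posnP n.
  exists (vertex R ord0); first exact: simplex_vertex.
  by rewrite Efun_vertex /kappa n0 eqxx.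
have mn := trunc_log_bounds n0; rewrite (kappaE mn).
set m := trunc_log 2 n in mn *.
have [|d d_le1 sumd] := @subvector_of_sum n.+1 (fun=> 1%N) (2 ^ m.+1 - n)%N.
  by rewrite sum1_card card_ord expnS; lia.
pose x : 'rV[R]_n.+1 := \row_k ((- cyc k + (1 + d k)%N%:R) / 2 ^+ m.+1).
have twoxE k : 2 ^+ m.+1 * x ord0 k = - cyc k + (1 + d k)%N%:R.
  by rewrite mxE mulrC mulfVK // expf_neq0.
have d1 k : (d k)%:R <= 1 :> R by rewrite lern1.
have Dx : Delta x.
  split=> [k|].
    rewrite mxE divr_ge0 ?exprn_ge0 // natrD.
    by have := cyc_le1 k; have := ler0n R (d k); lra.
  under eq_bigr do rewrite mxE natrD.
  rewrite -mulr_suml !big_split /= sumrN sum_cyc big_const_ord iter_addr_0.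
  rewrite -natr_sum sumd natrB ?natrX; last by case/andP: mn => _ /ltnW.
  rewrite -[n.+1%:R]natr1 [X in X / _](_ : _ = 2 ^+ m.+1); last by ring.
  by rewrite divff // expf_neq0.
exists x => //; rewrite (Efun_unfold x m.+1); congr (_ + _).
  rewrite (eq_bigr (fun=> 1)) => [|j _].
    by rewrite big_const_ord iter_addr_0 -[m.+1%:R]natr1.
  rewrite (_ : \sum_k _ = 2 ^+ j) ?divff ?expf_neq0 //.
  rewrite -[RHS](sum_scaled_simplex j Dx); apply: eq_bigr => k _.
  have x0 : 0 <= x ord0 k by case: Dx.
  rewrite frac_id ?mulr_ge0 ?exprn_ge0 //.
  have : 2 ^+ m.+1 * x ord0 k < 2.
    by rewrite twoxE natrD; have := cyc_gt0 k; have := d1 k; lra.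
  rewrite exprS -mulrA gtr_pMr // => xm1; apply: le_lt_trans xm1.
  by rewrite ler_wpM2r // ler_eXn2l ?ltr1n // -ltnS.
under eq_bigr do rewrite twoxE sawDn.
by rewrite sum_saw_cyc exprS; field; rewrite expf_neq0.
Qed.

End Max.

(** * Lower semicontinuity *)

Lemma lower_semicontinuous_subspace (R : numFieldType) (X : topologicalType)
    (A : set X) (f : X -> \bar R) :
  lower_semicontinuous f -> lower_semicontinuous (f : subspace A -> \bar R).
Proof.
move=> lscf x a afx; have [V xV Vf] := lscf x a afx.
exists V => //; case: (@nbhs_subspaceP _ A x) => _.
  by apply: filterS xV => y Vy _.
by move=> _ ->; exact: (nbhs_singleton xV).
Qed.

Section LSC.
Variables (R : realType) (n : nat).

Lemma frac_near_ge (t e : R) : 0 < e -> \forall s \near t, frac t - e <= frac s.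
Proof.
move=> e0; have t1 := floorD1_gt t; rewrite intrD in t1.
near=> s.
have st : t - e <= s by near: s; apply: lt_le_nbhsr; lra.
have s1 : s < (Num.floor t)%:~R + 1 by near: s; exact: lt_nbhsl.
by apply: le_trans (frac_le_subz s1); rewrite /frac; lra.
Unshelve. all: by end_near. Qed.

Lemma saw_near_ge (t e : R) : 0 < e -> \forall s \near t, saw t - e <= saw s.
Proof.
move=> e0.
(* Unfolding [saw_rec] [m] times bounds the error by the tail [2 / 2 ^+ m] and by
   [e/4 + e/8 + ...] for the fractional parts. *)
have main m : forall t, \forall s \near t, saw t - 2 / 2 ^+ m - e / 2 <= saw s.
  elim: m => [|m IH] {}t.
    near=> s; have := saw_ge0 s; have := saw_le2 t; rewrite expr0; lra.
  have dbl : (fun s : R => 2 * s) @ t --> 2 * t.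
    by apply: cvgMr; exact: cvg_id.
  have e4 : 0 < e / 4 by lra.
  have near2 := dbl _ (IH (2 * t)).
  near=> s; rewrite (saw_rec s) (saw_rec t) exprS invfM.
  have : frac t - e / 4 <= frac s by near: s; exact: frac_near_ge.
  have : saw (2 * t) - 2 / 2 ^+ m - e / 2 <= saw (2 * s) by near: s.
  lra.
have [m em] : exists m : nat, 2 / 2 ^+ m <= e / 2.
  exists (Num.truncn (4 / e)).+1; rewrite ler_pdivrMr ?exprn_gt0 //.
  have := truncnS_gt (4 / e); set p := (Num.truncn _).+1; rewrite ltr_pdivrMr // => ep.
  have : (p%:R : R) <= 2 ^+ p by rewrite -natrX ler_nat ltnW // ltn_expl.
  by rewrite -(ler_pM2r e0); lra.
apply: filterS (main m t) => s; lra.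
Unshelve. all: by end_near. Qed.

Lemma Efun_lower_semicontinuous :
  lower_semicontinuous (fun x : 'rV[R]_n.+1 => (Efun x)%:E).
Proof.
move=> x a; rewrite lte_fin => ax.
exists [set y | (a%:E < (Efun y)%:E)%E] => //.
pose e := (Efun x - a) / n.+2%:R.
have e0 : 0 < e by rewrite divr_gt0 // subr_gt0.
have nearx : nbhs x [set y : 'rV[R]_n.+1 |
    forall k, saw (x ord0 k) - e <= saw (y ord0 k)].
  apply: (@filter_forall _ _ (fun k (y : 'rV[R]_n.+1) =>
    saw (x ord0 k) - e <= saw (y ord0 k)) _ (nbhs_filter x)) => k.
  exact: (@coord_continuous R _ _ ord0 k x) _ (saw_near_ge (x ord0 k) e0).
apply: filterS nearx => y xy; rewrite /= lte_fin.
have : \sum_k (saw (x ord0 k) - e) <= Efun y by apply: ler_sum => k _; exact: xy.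
apply: lt_le_trans; rewrite sumrB big_const_ord iter_addr_0 -[\sum_k _]/(Efun x).
rewrite ltrBrDr -ltrBrDl -mulr_natr /e -mulrA gtr_pMr ?subr_gt0 //.
by rewrite mulrC ltr_pdivrMr // mul1r ltr_nat.
Qed.

End LSC.

(** * Conclusion *)

Section Conclusion.
Variables (R : realType) (n : nat).
Local Notation Delta := (@simplex R n).
Local Notation E := (@Efun R n).

Lemma Efun_bounded : [bounded E x | x in Delta].
Proof.
exists (kappa R n); split; first exact: num_real.
move=> M kM x Dx /=; rewrite ger0_norm ?Efun_ge0 //.
exact: le_trans (Efun_le_kappa Dx) (ltW kM).
Qed.

Lemma Efun_dominates : dominates_approx_convex E.
Proof.
move=> h hconv hreg hvert x Dx.
have [C hC] : exists C, forall y, Delta y -> h y <= C.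
  case: hreg => [[M [_ hM]]|hmeas].
    exists (M + 1) => y Dy; apply: le_trans (ler_norm _) _.
    by apply: (hM (M + 1)) => //; rewrite ltrDl.
  exists (2 * n.+1%:R) => y Dy.
  apply: (measurable_bounded_above hconv hmeas hvert Dy).
  by rewrite -[leqRHS]card_ord max_card.
exact: bounded_above_le_Efun hconv hvert hC x Dx.
Qed.

End Conclusion.

Theorem theorem2 (R : realType) (n : nat) :
  let E : 'rV[R]_n.+1 -> R := @Efun R n in
  let Delta : set 'rV[R]_n.+1 := @simplex R n in
  approx_convex Delta E
  /\ (forall k : 'I_n.+1, E (vertex R k) = 0)
  /\ dominates_approx_convex E
  /\ ((exists2 x, Delta x & E x = kappa R n)
      /\ (forall x, Delta x -> E x <= kappa R n))
  /\ lower_semicontinuous ((fun x => (E x)%:E) : subspace Delta -> \bar R)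
  /\ [bounded E x | x in Delta]
  /\ (forall F : 'rV[R]_n.+1 -> R,
        [bounded F x | x in Delta] ->
        approx_convex Delta F ->
        (forall k : 'I_n.+1, F (vertex R k) = 0) ->
        dominates_approx_convex F ->
        forall x, Delta x -> F x = E x).
Proof.
move=> E Delta; split; first exact: Efun_approx_convex.
split; first exact: Efun_vertex.
split; first exact: Efun_dominates.
split; first by split; [exact: Efun_max_attained|exact: Efun_le_kappa].
split.
  exact/lower_semicontinuous_subspace/Efun_lower_semicontinuous.
split; first exact: Efun_bounded.
move=> F Fbnd Fconv Fvert Fdom x Dx; apply/eqP; rewrite eq_le; apply/andP; split.
  by apply: Efun_dominates => //; [left|move=> k; rewrite Fvert].
apply: Fdom => //; first exact: Efun_approx_convex.
- by left; exact: Efun_bounded.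
- by move=> k; rewrite /E Efun_vertex.
Qed.
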